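(* Let $(A,\sigma)$ be a real Hermitian algebra, $G=\mathrm{Sp}_2(A,\sigma)$, and let $\mathfrak{C}_G$ be the space of complex structures. For $J\in\mathfrak{C}_G$, the tangent space of $\mathfrak{C}_G$ at $J$ is $$T_J\mathfrak{C}_G=\left\{L\colon A^2\to A^2\mid L\text{ is }A\text{-linear},\ h_L\text{ is }\sigma\text{-symmetric, and }LJ+JL=0\right\}.$$ The group $\mathrm{Sp}_2(A,\sigma)$ acts on $T\mathfrak{C}_G$ by conjugation, i.e. $g.(J,L)=(gJg^{-1},gLg^{-1})$. In particular, $T_{gJg^{-1}}\mathfrak{C}_G=g\,T_J\mathfrak{C}_G\,g^{-1}$.
   Context: $A$ is a unital associative, possibly noncommutative, finite-dimensional semisimple $\mathbb{R}$-algebra and $\sigma\colon A\to A$ is an anti-involution: $\mathbb{R}$-linear, $\sigma(ab)=\sigma(b)\sigma(a)$, $\sigma^2=\mathrm{Id}$. Put $A^\sigma=\{a\in A\mid\sigma(a)=a\}$, $A^\times$ the group of invertible elements, $\mathrm{O}(A,\sigma)=\{a\in A^\times\mid \sigma(a)=a^{-1}\}$, $A^\sigma_+=\{a^2\mid a\in A^\sigma\cap A^\times\}$, $A^\sigma_{\ge 0}=\{a^2\mid a\in A^\sigma\}$. The pair $(A,\sigma)$ is Hermitian if for $x,y\in A^\sigma$, $x^2+y^2=0$ implies $x=y=0$; as standing properties of Hermitian algebras, $A^\sigma_+$ and $A^\sigma_{\ge0}$ are proper convex cones in $A^\sigma$, $\mathrm{O}(A,\sigma)$ is compact, and $x\mapsto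 ax\sigma(a)$ preserves $A^\sigma_+$ and $A^\sigma_{\geq 0}$ for every $a\in A^\times$. $A^2$ is the right $A$-module of columns; $x\in A^2$ is regular if there is $y\in A^2$ such that $(a,b)\mapsto xa+yb$ is an isomorphism $A^2\to A^2$ of right $A$-modules. For $x,y\in A^2$ let $\omega(x,y)=\sigma(x)^t\begin{pmatrix}0&1\\-1&0\end{pmatrix}y$; $\mathrm{Sp}_2(A,\sigma)$ is the group of $A$-linear automorphisms of $A^2$ preserving $\omega$. For an $A$-linear $L\colon A^2\to A^2$ put $h_L(x,y)=\omega(L(x),y)$. A form $b\colon A^2\times A^2\to A$ that is biadditive with $b(xr_1,yr_2)=\sigma(r_1)b(x,y)r_2$ is $\sigma$-symmetric if $b(x,y)=\sigma(b(y,x))$ for all $x,y$; it is a $\sigma$-inner product if moreover for all regular $x$, $b(x,x)\in A^\sigma_{\geq0}$, with $b(x,x)=0$ if and only if $x=0$. A complex structure on $A^2$ is an $A$-linear $J\colon A^2\to A^2$ with $J^2=-\mathrm{Id}$; $\mathfrak{C}_G$ is the set of complex structures $J$ on $A^2$ for which $h_J$ is a $\sigma$-inner product. It is a smooth manifold on which $G$ acts smoothly and transitively by conjugation, and tangent vectors are regarded as elements of $\mathrm{End}_A(A^2)$. *)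

(* Defs.v *)
From HB Require Import structures.
From mathcomp Require Import all_boot all_order all_algebra all_field.
From mathcomp Require Import all_classical all_reals all_analysis.

Set Implicit Arguments.
Unset Strict Implicit.
Unset Printing Implicit Defensive.

Import Order.TTheory GRing.Theory Num.Theory.
Import numFieldNormedType.Exports.

Local Open Scope classical_set_scope.
Local Open Scope ring_scope.

Section HermitianAlgebra.
Variables (R : realType) (A : falgType R).

Definition right_ideal (U : {vspace A}) : Prop :=
  forall u a : A, u \in U -> u * a \in U.

(* Semisimplicity of A as a right module over itself; right ideals of a unital
   algebra are linear subspaces, so quantifying over {vspace A} loses nothing. *)
Definition semisimple_algebra : Prop :=
  forall U : {vspace A}, right_ideal U ->
  exists V : {vspace A},
    [/\ right_ideal V, (U :&: V = 0)%VS & (U + V = fullv)%VS].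

Variable sigma : A -> A.

Definition anti_involution : Prop :=
  [/\ linear sigma,
      forall a b : A, sigma (a * b) = sigma b * sigma a
    & forall a : A, sigma (sigma a) = a].

Definition fixed_part : set A := [set a | sigma a = a].

Definition nonneg_cone : set A := [set a ^+ 2 | a in fixed_part].

Definition hermitian_algebra : Prop :=
  forall x y : A, fixed_part x -> fixed_part y ->
  x ^+ 2 + y ^+ 2 = 0 -> x = 0 /\ y = 0.

End HermitianAlgebra.

Section RightModule.
Variables (R : realType) (A : falgType R).

(* A^2 is the R-vector space A * A of columns (x.1, x.2), with A acting on the
   right.  It must not be confused with the product ring structure on pairs. *)
Definition rscale (x : A * A) (a : A) : A * A := (x.1 * a, x.2 * a).

Definition rmod_linear (f : A * A -> A * A) : Prop :=
  (forall x y, f (x + y) = f x + f y) /\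
  (forall x a, f (rscale x a) = rscale (f x) a).

Definition rmod_iso (f : A * A -> A * A) : Prop := rmod_linear f /\ bijective f.

Definition regular_vector (x : A * A) : Prop :=
  exists y : A * A, rmod_iso (fun p => rscale x p.1 + rscale y p.2).

Variable sigma : A -> A.

(* sigma(x)^t * ((0, 1), (-1, 0)) * y, multiplied out *)
Definition omega (x y : A * A) : A := sigma x.1 * y.2 - sigma x.2 * y.1.

Definition sesquilinear_form (b : A * A -> A * A -> A) : Prop :=
  [/\ forall x x' y, b (x + x') y = b x y + b x' y,
      forall x y y', b x (y + y') = b x y + b x y'
    & forall x y r s, b (rscale x r) (rscale y s) = sigma r * b x y * s].

Definition sigma_symmetric (b : A * A -> A * A -> A) : Prop :=
  sesquilinear_form b /\ (forall x y, b x y = sigma (b y x)).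

Definition sigma_inner_product (b : A * A -> A * A -> A) : Prop :=
  [/\ sigma_symmetric b,
      forall x, regular_vector x -> nonneg_cone sigma (b x x)
    & forall x, b x x = 0 <-> x = 0].

Definition hform (L : A * A -> A * A) (x y : A * A) : A := omega (L x) y.

(* A-linear maps are R-linear, so End_A(A^2) sits inside the finite-dimensional
   real vector space 'End(A * A) as the elements satisfying rmod_linear. *)
Local Notation End2 := ('End((A * A)%type)).

Definition Sp2 : set End2 :=
  [set g | rmod_iso g /\ forall x y, omega (g x) (g y) = omega x y].

Definition complex_structure (J : End2) : Prop :=
  rmod_linear J /\ (J \o J)%VF = - \1%VF.

Definition CG : set End2 :=
  [set J | complex_structure J /\ sigma_inner_product (hform J)].

(* g^-1 is the two-sided inverse whenever g is bijective, as in Sp2. *)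
Definition conj_by (g L : End2) : End2 := (g \o L \o g^-1)%VF.

Definition conj_pair (g : End2) (p : End2 * End2) : End2 * End2 :=
  (conj_by g p.1, conj_by g p.2).

End RightModule.

(* Submanifolds of a finite-dimensional real vector space V: tangent vectors are
   velocities of smooth curves.  Smoothness and derivatives are computed in
   coordinates, V carrying no chosen norm; they do not depend on the basis. *)
Section TangentSpace.
Variables (R : realType) (V : vectType R).

Definition coord_fun (gamma : R -> V) (i : 'I_(\dim (fullv : {vspace V}))) :
  R -> R := fun t => coord (vbasis fullv) i (gamma t).

Definition smooth_at (gamma : R -> V) (t : R) : Prop :=
  forall i n, derivable (derive1n n (coord_fun gamma i)) t 1.

Definition velocity (gamma : R -> V) (t : R) : V :=
  \sum_i derive1 (coord_fun gamma i) t *: (vbasis fullv)`_i.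

(* gamma is a smooth curve ]-e, e[ -> M through p at time 0; values of gamma
   outside ]-e, e[ are irrelevant. *)
Definition curve_through (M : set V) (p : V) (gamma : R -> V) : Prop :=
  gamma 0 = p /\
  exists2 e : R, 0 < e &
    forall t, `|t| < e -> smooth_at gamma t /\ M (gamma t).

Definition tangent_space (M : set V) (p : V) : set V :=
  [set v | exists2 gamma : R -> V,
      curve_through M p gamma & velocity gamma 0 = v].

Definition tangent_bundle (M : set V) : set (V * V) :=
  [set pv | M pv.1 /\ tangent_space M pv.1 pv.2].

End TangentSpace.

Definition group_acts_on (R : realType) (W : vectType R) (T : Type)
    (G : set 'End(W)) (X : set T) (act : 'End(W) -> T -> T) : Prop :=
  [/\ [/\ G \1%VF,
          forall g h, G g -> G h -> G (g \o h)%VF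
        & forall g, G g ->
            [/\ G (g^-1)%VF, (g \o g^-1 = \1)%VF & (g^-1 \o g = \1)%VF]],
      forall g x, G g -> X x -> X (act g x),
      forall x, X x -> act \1%VF x = x
    & forall g h x, G g -> G h -> X x -> act (g \o h)%VF x = act g (act h x)].

(* Main.v *)
(* Membership in CG forces the equations "L is A-linear" and
   "omega(L x, y) + omega(x, L y) = 0", which are linear in L, and L o L = -1;
   differentiating them along a curve gives the three conditions on a tangent
   vector.  Conversely, let L satisfy these conditions and put Y = - L J / 4.
   Then Y is A-linear, skew for omega and anticommutes with J, so for small t the
   Cayley transform g(t) = (1 + t Y) (1 - t Y)^-1 lies in Sp2, and the curve
   g(t) J g(t)^-1 = g(t)^2 J stays in CG because CG is stable under conjugation.
   By Cramer's rule it is rational in t, hence smooth, and its velocity at 0 is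
   2 (Y J - J Y) = L. *)
Require Import Defs.
From HB Require Import structures.
From mathcomp Require Import all_boot all_order all_algebra all_field.
From mathcomp Require Import all_classical all_reals all_analysis.
From mathcomp Require Import ring.

Set Implicit Arguments.
Unset Strict Implicit.
Unset Printing Implicit Defensive.

Import Order.TTheory GRing.Theory Num.Theory.
Import numFieldNormedType.Exports.

Local Open Scope classical_set_scope.
Local Open Scope ring_scope.

(** * Smooth functions of one real variable on a symmetric interval *)

Section SmoothFunctions.
Variable R : realType.
Implicit Types (f h : R -> R) (e t : R).

Lemma near_ball0 e t : `|t| < e -> \forall s \near t, `|s| < e.
Proof.
move=> te; have /= := @cvgr_norm_lt R R R (nbhs t) _ id t cvg_id.
exact.
Qed.

(** By induction each iterated derivative agrees on ]-e, e[ with some member of [K]. The interval is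
    open, so the agreement holds near each of its points and survives one more differentiation,
    whatever happens outside. *)
Lemma smooth_of_derivation_closed (K : set (R -> R)) e :
    (forall h, K h -> exists2 h', K h' &
       forall t, `|t| < e -> is_derive t 1 h (h' t)) ->
  forall h n t, K h -> `|t| < e -> derivable (derive1n n h) t 1.
Proof.
move=> Kder h n.
have key t f f' : `|t| < e -> (forall s, `|s| < e -> f s = f' s) ->
    \forall s \near t, f' s = f s.
  by move=> te ff'; near=> s; rewrite ff'//; near: s; exact: near_ball0.
move=> t Kh te.
have [f Kf hf] : exists2 f, K f & forall s, `|s| < e -> derive1n n h s = f s.
  elim: n => [|n [f Kf hf]]; first by exists h.
  have [f' Kf' ff'] := Kder _ Kf; exists f' => // s se.
  rewrite derive1nS derive1E.
  have /near_eq_derive -> := key _ _ _ se (fun u ue => esym (hf u ue)).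
  by have [_ ->] := ff' _ se.
have [f' _ /(_ _ te) [ff' _]] := Kder _ Kf.
exact: near_eq_derivable (key _ _ _ te hf) ff'.
Unshelve. all: by end_near. Qed.

(** The quotients p / q^j, with q fixed and j arbitrary, are closed under differentiation: (p /
    q^j)' = (p' q - j p q') / q^(j+1). *)
Lemma smooth_rational (p q : {poly R}) (k : nat) e n t :
    (forall s, `|s| < e -> q.[s] != 0) -> `|t| < e ->
  derivable (derive1n n (fun s => p.[s] / q.[s] ^+ k)) t 1.
Proof.
move=> q0 te.
pose K := [set h | exists (p' : {poly R}) j, h = fun s => p'.[s] / q.[s] ^+ j].
apply: (@smooth_of_derivation_closed K e) => //; last by exists p, k.
move=> _ [p' [j ->]].
exists (fun s => (p'^`() * q - p' * q^`() *+ j).[s] / q.[s] ^+ j.+1).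
  by exists (p'^`() * q - p' * q^`() *+ j), j.+1.
move=> s se; have qs := q0 _ se.
have dX : is_derive s 1 (horner q ^+ j) ((j%:R * q.[s] ^+ j.-1) *: q^`().[s]).
  exact: is_deriveX.
have dV : is_derive s 1 (fun u => ((horner q ^+ j) u)^-1)
    (- ((horner q ^+ j) s) ^- 2 *: ((j%:R * q.[s] ^+ j.-1) *: q^`().[s])).
  by apply: is_deriveV; rewrite exprfctE expf_neq0.
have := is_deriveM (is_derive_poly p' s) dV.
rewrite (_ : horner p' * _ = fun u => p'.[u] / q.[u] ^+ j); last first.
  by apply/funext => u; rewrite !fctE.
move=> H; apply: (is_derive_eq H).
rewrite !exprfctE !(hornerE, hornerMn) /= /GRing.scale /= -mulr_natl.
(* The derivative of q^j carries the truncated exponent [j.-1], so j = 0 is treated apart. *)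
case: j {dX dV H} => [|j] /=; first by rewrite !expr0 expr1 !mul0r; field.
by rewrite !exprS; field; rewrite qs expf_neq0.
Qed.

(** With the coefficients [c] fixed, differentiating such a sum only replaces each smooth summand by
    its derivative, so these sums form a class closed under differentiation. *)
Lemma smooth_sumZ m (c : 'I_m -> R) (F : 'I_m -> R -> R) e n t :
    (forall i k s, `|s| < e -> derivable (derive1n k (F i)) s 1) ->
    `|t| < e ->
  derivable (derive1n n (fun s => \sum_(i < m) c i * F i s)) t 1.
Proof.
move=> Fsmooth te.
pose K := [set h | exists2 G : 'I_m -> R -> R,
  (forall i k s, `|s| < e -> derivable (derive1n k (G i)) s 1) &
  h = fun s => \sum_(i < m) c i * G i s].
apply: (@smooth_of_derivation_closed K e) => //; last by exists F.
move=> _ [G Gs ->].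
exists (fun s => \sum_(i < m) c i * (derive1 (G i)) s).
  by exists (fun i => derive1 (G i)) => // i k s se; rewrite -derive1Sn; exact: Gs.
move=> s se.
have dG i : is_derive s 1 (c i \*: G i) (c i *: derive1 (G i) s).
  apply: is_deriveZ; rewrite derive1E; apply: DeriveDef => //.
  exact: (Gs i 0).
have := is_derive_sum dG.
by rewrite (_ : \sum_i _ = fun u => \sum_(i < m) c i * G i u)//;
  apply/funext => u; rewrite fct_sumE.
Qed.

End SmoothFunctions.

(** * Calculus of velocities in a finite-dimensional space *)

Section Velocity.
Variable R : realType.
Implicit Types (U V W : vectType R) (t e : R).

(** Relational form of [velocity]. It also asserts that the coordinates are derivable, whereas
    [velocity] is a total function that returns some value even when they are not. *)
Definition is_velocity V (gamma : R -> V) t (v : V) : Prop :=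
  forall i, is_derive t 1 (coord_fun gamma i) (coord (vbasis fullv) i v).

Lemma is_velocityE V (gamma : R -> V) t v :
  is_velocity gamma t v -> velocity gamma t = v.
Proof.
move=> gv; rewrite /velocity [RHS](coord_vbasis (memvf v)).
by apply: eq_bigr => i _; rewrite derive1E; have [_ ->] := gv i.
Qed.

Lemma smooth_at_velocity V (gamma : R -> V) t :
  smooth_at gamma t -> is_velocity gamma t (velocity gamma t).
Proof.
move=> gs i; rewrite /velocity coord_sum_free ?(basis_free (vbasisP _))//.
by rewrite derive1E; apply: DeriveDef => //; exact: (gs i 0).
Qed.

Lemma near_eq_is_velocity V (f g : R -> V) t v :
  (\forall s \near t, f s = g s) -> is_velocity f t v -> is_velocity g t v.
Proof.
move=> fg fv i; apply: near_eq_is_derive (fv i).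
by apply: filterS fg => s; rewrite /coord_fun => ->.
Qed.

Lemma is_velocity_cst V (v : V) t : is_velocity (fun=> v) t 0.
Proof. by move=> i; rewrite linear0; exact: is_derive_cst. Qed.

Lemma is_velocity_unique V (gamma : R -> V) t v w :
  is_velocity gamma t v -> is_velocity gamma t w -> v = w.
Proof. by move=> /is_velocityE <- /is_velocityE <-. Qed.

(** Reduces statements about the image of a curve under a linear map to fixed linear combinations of
    scalar functions. *)
Lemma coord_fun_linear V W (phi : {linear V -> W}) (gamma : R -> V) i :
  coord_fun (phi \o gamma) i =
  fun s => \sum_(j < \dim (fullv : {vspace V}))
    coord (vbasis fullv) i (phi (vbasis fullv)`_j) * coord_fun gamma j s.
Proof.
apply/funext => s; rewrite /coord_fun /= [in LHS](coord_vbasis (memvf (gamma s))).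
by rewrite !linear_sum; apply: eq_bigr => j _; rewrite !linearZ /= mulrC.
Qed.

Lemma is_velocity_linear V W (phi : {linear V -> W}) (gamma : R -> V) t v :
  is_velocity gamma t v -> is_velocity (phi \o gamma) t (phi v).
Proof.
move=> gv i; rewrite coord_fun_linear.
set c := fun j : 'I_(\dim (fullv : {vspace V})) =>
  coord (vbasis fullv) i (phi (vbasis fullv)`_j).
have dG j : is_derive t 1 (c j \*: coord_fun gamma j)
    (c j *: coord (vbasis fullv) j v).
  exact: is_deriveZ (gv j).
have /is_derive_eq := is_derive_sum dG.
rewrite (_ : \sum_i _ = fun u => \sum_j c j * coord_fun gamma j u); last first.
  by apply/funext => u; rewrite fct_sumE.
apply; rewrite [in RHS](coord_vbasis (memvf v)) !linear_sum.
by apply: eq_bigr => j _; rewrite !linearZ /= mulrC.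
Qed.

Lemma smooth_linear V W (phi : {linear V -> W}) (gamma : R -> V) e t :
  (forall s, `|s| < e -> smooth_at gamma s) -> `|t| < e ->
  smooth_at (phi \o gamma) t.
Proof.
move=> gs te i n; rewrite coord_fun_linear.
by apply: (smooth_sumZ (e := e)) => // j k s se; exact: gs.
Qed.

Lemma is_velocity_affine V (v w : V) t : is_velocity (fun s => v + s *: w) t w.
Proof.
move=> i; rewrite (_ : coord_fun _ i =
    horner ((coord (vbasis fullv) i v)%:P + coord (vbasis fullv) i w *: 'X)).
  by apply: (is_derive_eq (is_derive_poly _ t));
  rewrite derivD derivC derivZ derivX add0r alg_polyC hornerC.
by apply/funext => s; rewrite /coord_fun linearD linearZ_LR /= !hornerE mulrC.
Qed.

(** Along a curve in [M] the composite with [phi] vanishes near 0, so its velocity, the image under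
    [phi] of that of the curve, is 0 by uniqueness. *)
Lemma linear_constraint_tangent V W (phi : V -> W) (M : set V) p v :
  linear phi -> (forall q, M q -> phi q = 0) -> tangent_space M p v -> phi v = 0.
Proof.
move=> phi_lin phi0 [gamma [_ [e e0 gM]] <-].
pose psi : {linear V -> W} := HB.pack phi
  (GRing.isSemilinear.Build _ _ _ _ _ (GRing.semilinear_linear phi_lin)).
have z0 : `|0 : R| < e by rewrite normr0.
have /is_velocity_unique := is_velocity_linear psi (smooth_at_velocity (gM 0 z0).1).
apply; apply: near_eq_is_velocity (is_velocity_cst 0 0).
by apply: filterS (near_ball0 z0) => s /gM [_ /phi0].
Qed.

Section Bilinear.
Variables (U V W : vectType R) (B : U -> V -> W).
Hypotheses (Bl : forall v, linear (B^~ v)) (Br : forall u, linear (B u)).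

Let Bl_linear v : {linear U -> W} := HB.pack (B^~ v)
  (GRing.isSemilinear.Build _ _ _ _ _ (GRing.semilinear_linear (Bl v))).
Let Br_linear u : {linear V -> W} := HB.pack (B u)
  (GRing.isSemilinear.Build _ _ _ _ _ (GRing.semilinear_linear (Br u))).

Lemma bilinear_coordE u v :
  B u v = \sum_(j < \dim (fullv : {vspace U}))
          \sum_(k < \dim (fullv : {vspace V}))
    (coord (vbasis fullv) j u * coord (vbasis fullv) k v) *:
      B (vbasis fullv)`_j (vbasis fullv)`_k.
Proof.
rewrite [in LHS](coord_vbasis (memvf u)) [LHS](linear_sum (Bl_linear v)).
apply: eq_bigr => j _; rewrite linearZ_LR -[Bl_linear v _]/(B _ v).
rewrite [in LHS](coord_vbasis (memvf v)).
rewrite [B _ _](linear_sum (Br_linear (vbasis fullv)`_j)) scaler_sumr.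
by apply: eq_bigr => k _; rewrite linearZ_LR scalerA.
Qed.

Lemma coord_fun_bilinear (f : R -> U) (g : R -> V) i :
  coord_fun (fun s => B (f s) (g s)) i =
  fun s => \sum_j \sum_k
    coord_fun f j s * coord_fun g k s *
      coord (vbasis fullv) i (B (vbasis fullv)`_j (vbasis fullv)`_k).
Proof.
apply/funext => s; rewrite {1}/coord_fun bilinear_coordE linear_sum.
apply: eq_bigr => j _; rewrite linear_sum.
by apply: eq_bigr => k _; rewrite linearZ.
Qed.

(** The product rule: in coordinates a bilinear map is a fixed combination of products of scalar
    functions, to which the scalar Leibniz rule applies. *)
Lemma is_velocity_bilinear (f : R -> U) (g : R -> V) t u v :
  is_velocity f t u -> is_velocity g t v ->
  is_velocity (fun s => B (f s) (g s)) t (B u (g t) + B (f t) v).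
Proof.
move=> fu gv i; rewrite coord_fun_bilinear.
pose c (j : 'I_(\dim (fullv : {vspace U}))) (k : 'I_(\dim (fullv : {vspace V})))
  : R := coord (vbasis fullv) i (B (vbasis fullv)`_j (vbasis fullv)`_k).
have dfg j k : is_derive t 1 (c j k \*: (coord_fun f j * coord_fun g k))
   (c j k *: (coord_fun f j t *: coord (vbasis fullv) k v +
              coord_fun g k t *: coord (vbasis fullv) j u)).
  by apply: is_deriveZ; apply: is_deriveM; [exact: fu|exact: gv].
have := is_derive_sum (fun j => is_derive_sum (dfg j)).
rewrite (_ : \sum_i _ = fun s => \sum_j \sum_k
    coord_fun f j s * coord_fun g k s * c j k); last first.
  apply/funext => s; rewrite fct_sumE; apply: eq_bigr => j _.
  by rewrite fct_sumE; apply: eq_bigr => k _; rewrite [RHS]mulrC.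
move/is_derive_eq; apply.
rewrite linearD /= !bilinear_coordE !linear_sum -big_split.
apply: eq_bigr => j _; rewrite !linear_sum -big_split.
apply: eq_bigr => k _; rewrite !linearZ_LR /= -/(c j k).
by rewrite /GRing.scale /= /coord_fun; ring.
Qed.
End Bilinear.
End Velocity.

(** * Polynomial curves and rationality of the resolvent *)

Section PolynomialCurves.
Import passmx.
Variable R : realType.

Definition polynomial_curve (V : vectType R) (gamma : R -> V) : Prop :=
  forall i, exists p : {poly R}, coord_fun gamma i =1 horner p.

Lemma polynomial_curve_affine (V : vectType R) (v w : V) :
  polynomial_curve (fun t => v + t *: w).
Proof.
move=> i; exists ((coord (vbasis fullv) i v)%:P + (coord (vbasis fullv) i w) *: 'X).
by move=> t; rewrite /coord_fun linearD linearZ_LR /= !hornerE mulrC.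
Qed.

Lemma polynomial_curve_cst (V : vectType R) (v : V) :
  polynomial_curve (fun=> v).
Proof. by move=> i; exists (coord (vbasis fullv) i v)%:P => t; rewrite hornerC. Qed.

Lemma polynomial_curve_bilinear (U V W : vectType R) (B : U -> V -> W)
    (f : R -> U) (g : R -> V) :
    (forall v, linear (B^~ v)) -> (forall u, linear (B u)) ->
    polynomial_curve f -> polynomial_curve g ->
  polynomial_curve (fun t => B (f t) (g t)).
Proof.
move=> Bl Br /choice[p fp] /choice[q gq] i; rewrite coord_fun_bilinear//.
exists (\sum_j \sum_k
  p j * q k * (coord (vbasis fullv) i (B (vbasis fullv)`_j (vbasis fullv)`_k))%:P).
move=> t; rewrite horner_sum; apply: eq_bigr => j _.
by rewrite horner_sum; apply: eq_bigr => k _; rewrite fp gq !hornerE.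
Qed.

Lemma smooth_rational_curve (V : vectType R) (gamma : R -> V) (q : {poly R}) k e t :
    polynomial_curve gamma -> (forall s, `|s| < e -> q.[s] != 0) -> `|t| < e ->
  smooth_at (fun s => q.[s] ^- k *: gamma s) t.
Proof.
move=> gp q0 te i n; have [p hp] := gp i.
rewrite (_ : coord_fun _ i = fun s => p.[s] / q.[s] ^+ k).
  exact: (@smooth_rational _ _ _ _ e).
by apply/funext => s; rewrite /coord_fun linearZ_LR /= -hp mulrC.
Qed.

(** Cramer's rule: for the matrix M of [Y], [d] is det(1 - tM) and [N t] is the adjugate of 1 - tM.
    The two identities hold for every t, including the roots of [d]. *)
Lemma resolvent_rational (W : vectType R) (Y : 'End(W)) :
  exists (d : {poly R}) (N : R -> 'End(W)),
    [/\ polynomial_curve N, d.[0] = 1 &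
      forall t, ((\1 - t *: Y) \o N t = d.[t] *: \1)%VF /\
                (N t \o (\1 - t *: Y) = d.[t] *: \1)%VF].
Proof.
pose b := vbasis (fullv : {vspace W}).
have bP : basis_of fullv b := vbasisP _.
pose M := mxof b b Y.
(* The pencil 1 - tM is taken over polynomials in t. Evaluation is a ring morphism, hence commutes
   with determinant and adjugate, which are therefore polynomial in t. *)
pose P : 'M[{poly R}]_(\dim (fullv : {vspace W})) :=
  1%:M - 'X *: map_mx polyC M.
have PE t : map_mx (horner_eval t) P = 1%:M - t *: M.
  rewrite map_mxB map_mx1 map_mxZ; congr (_ - _ *: _).
    by rewrite /= /horner_eval hornerX.
  by apply/matrixP => i j; rewrite !mxE /= /horner_eval hornerC.
have pencilE t : hommx b b (1%:M - t *: M) = \1%VF - t *: Y.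
  by rewrite linearB linearZ_LR /= hommx1// mxofK.
have detE t : (\det P).[t] = \det (1%:M - t *: M).
  by rewrite -PE det_map_mx.
exists (\det P), (fun t => hommx b b (\adj (1%:M - t *: M))); split.
(* The chosen basis of ['End(W)] need not consist of matrix units, so the adjugate is first expanded
   over the matrices [delta_mx j k]. *)
- move=> i; exists (\sum_j \sum_k
    (\adj P) j k * (coord (vbasis fullv) i (hommx b b (delta_mx j k)))%:P) => t.
  rewrite /coord_fun -PE -map_mx_adj [X in hommx _ _ X]matrix_sum_delta.
  rewrite !linear_sum horner_sum; apply: eq_bigr => j _.
  rewrite !linear_sum horner_sum; apply: eq_bigr => k _.
  by rewrite !linearZ_LR /= !hornerE mxE.
- by rewrite detE scale0r subr0 det1.
move=> t; rewrite -pencilE -!hommx_mul// mul_adj_mx mul_mx_adj detE.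
by rewrite -[(\det _)%:M]scalemx1 linearZ_LR /= hommx1.
Qed.

End PolynomialCurves.

(** * Composition and inversion of endomorphisms *)

Section EndomorphismProduct.
Variables (R : realType) (W : vectType R).

Lemma comp_lfun_linearl (g : 'End(W)) : linear (fun f : 'End(W) => f \o g)%VF.
Proof. by move=> a f1 f2; rewrite comp_lfunDl -comp_lfunZl. Qed.

Lemma comp_lfun_linearr (f : 'End(W)) : linear (fun g : 'End(W) => f \o g)%VF.
Proof. by move=> a g1 g2; rewrite comp_lfunDr -comp_lfunZr. Qed.

Lemma is_velocity_comp_lfun (f g : R -> 'End(W)) t u v :
  is_velocity f t u -> is_velocity g t v ->
  is_velocity (fun s => f s \o g s)%VF t ((u \o g t) + (f t \o v))%VF.
Proof.
exact: (is_velocity_bilinear (B := fun f g : 'End(W) => (f \o g)%VF)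
  comp_lfun_linearl comp_lfun_linearr).
Qed.

Lemma polynomial_curve_comp_lfun (f g : R -> 'End(W)) :
  polynomial_curve f -> polynomial_curve g ->
  polynomial_curve (fun t => f t \o g t)%VF.
Proof.
exact: (polynomial_curve_bilinear (B := fun f g : 'End(W) => (f \o g)%VF)
  comp_lfun_linearl comp_lfun_linearr).
Qed.

Lemma lker0_bij (g : 'End(W)) : bijective g <-> lker g == 0%VS.
Proof.
split=> [/bij_inj/lker0P //|g0].
by exists (g^-1)%VF; [exact: lker0_lfunK|exact: lker0_lfunVK].
Qed.

(** In general [g^-1] is only a generalized inverse; an explicit two-sided inverse [h] both gives
    bijectivity and identifies it. *)
Lemma lfun_inv_uniq (g h : 'End(W)) :
  (g \o h = \1)%VF -> (h \o g = \1)%VF -> bijective g /\ (g^-1)%VF = h.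
Proof.
move=> gh hg; have gb : bijective g.
  by exists h => x; rewrite -comp_lfunE ?gh ?hg id_lfunE.
split=> //; have /lker0_bij g0 := gb.
by rewrite -[LHS]comp_lfun1r -gh lker0_compKf.
Qed.

End EndomorphismProduct.

(** * The symplectic group and its conjugation action on complex structures *)

Section SymplecticGroup.
Variables (R : realType) (A : falgType R) (sigma : A -> A).
Hypothesis hanti : anti_involution sigma.
Local Notation W := (A * A)%type.
Local Notation E := ('End((A * A)%type)).
Implicit Types (g h J L X Y : E) (x y : W) (a r s : A).

Let sigma_linear : linear sigma. Proof. by case: hanti. Qed.
Let sigmaM a r : sigma (a * r) = sigma r * sigma a.
Proof. by case: hanti. Qed.
Let sigmaK a : sigma (sigma a) = a. Proof. by case: hanti. Qed.

Let sigma_lmap : {linear A -> A} := HB.pack sigma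
  (GRing.isSemilinear.Build _ _ _ _ _ (GRing.semilinear_linear sigma_linear)).
Let sigmaD a r : sigma (a + r) = sigma a + sigma r.
Proof. exact: (linearD sigma_lmap). Qed.
Let sigmaB a r : sigma (a - r) = sigma a - sigma r.
Proof. exact: (linearB sigma_lmap). Qed.
Let sigmaZ c a : sigma (c *: a) = c *: sigma a.
Proof. exact: (linearZ_LR sigma_lmap). Qed.

Lemma rscale_linear a : linear ((@rscale R A)^~ a).
Proof.
by move=> c x y; rewrite /rscale; congr pair; rewrite /= mulrDl -scalerAl.
Qed.

Lemma omega_sigma x y : sigma (omega sigma x y) = - omega sigma y x.
Proof. by rewrite /omega sigmaB !sigmaM !sigmaK opprB. Qed.

Lemma omega_rscale x y r s :
  omega sigma (rscale x r) (rscale y s) = sigma r * omega sigma x y * s.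
Proof. by rewrite /omega /rscale /= !sigmaM mulrBr mulrBl !mulrA. Qed.

Lemma omegaDl x y z : omega sigma (x + y) z = omega sigma x z + omega sigma y z.
Proof. by rewrite /omega /= !sigmaD !mulrDl opprD addrACA. Qed.

Lemma omegaDr x y z : omega sigma x (y + z) = omega sigma x y + omega sigma x z.
Proof. by rewrite /omega /= !mulrDr opprD addrACA. Qed.

Lemma omegaZl c x y : omega sigma (c *: x) y = c *: omega sigma x y.
Proof. by rewrite /omega /= !sigmaZ -!scalerAl -scalerBr. Qed.

Lemma omegaZr c x y : omega sigma x (c *: y) = c *: omega sigma x y.
Proof. by rewrite /omega /= -!scalerAr -scalerBr. Qed.

Lemma rmod_linear_lfun L :
  (forall x a, L (rscale x a) = rscale (L x) a) -> rmod_linear L.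
Proof. by move=> HL; split=> // x y; rewrite linearD. Qed.

Lemma rmod_linear_comp (f g : W -> W) :
  rmod_linear f -> rmod_linear g -> rmod_linear (f \o g).
Proof. by move=> [fD fZ] [gD gZ]; split=> x y /=; rewrite ?gD ?fD ?gZ ?fZ. Qed.

Lemma rmod_linear_comp_lfun L X :
  rmod_linear L -> rmod_linear X -> rmod_linear (L \o X)%VF.
Proof.
move=> [_ LZ] [_ XZ]; apply: rmod_linear_lfun => x a.
by rewrite !comp_lfunE XZ LZ.
Qed.

Lemma rmod_linear_affine (c : R) L :
  rmod_linear L -> rmod_linear (\1 + c *: L)%VF.
Proof.
move=> [_ LZ]; apply: rmod_linear_lfun => x a.
rewrite !(add_lfunE, scale_lfunE, id_lfunE) LZ addrC [in RHS]addrC.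
by rewrite rscale_linear.
Qed.

Lemma rmod_linear_inv g : rmod_linear g -> bijective g -> rmod_linear (g^-1)%VF.
Proof.
move=> [_ gZ] /lker0_bij g0; apply: rmod_linear_lfun => x a.
by apply: (lker0P g0); rewrite gZ !lker0_lfunVK.
Qed.

Lemma rmod_iso_comp (f g : W -> W) :
  rmod_iso f -> rmod_iso g -> rmod_iso (f \o g).
Proof.
by move=> [fl fb] [gl gb]; split; [exact: rmod_linear_comp|exact: bij_comp].
Qed.

Lemma rmod_iso_inv g : rmod_iso g -> rmod_iso (g^-1)%VF.
Proof.
move=> [gl gb]; split; first exact: rmod_linear_inv.
have /lker0_bij g0 := gb.
by exists g; [exact: lker0_lfunVK|exact: lker0_lfunK].
Qed.

(** If y completes x to a basis, then f y completes f x: the new parametrization of the module is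
    the old one followed by f. *)
Lemma regular_vector_iso (f : W -> W) x :
  rmod_iso f -> regular_vector x -> regular_vector (f x).
Proof.
move=> fi [y xy]; exists (f y).
suff -> : (fun p : W => rscale (f x) p.1 + rscale (f y) p.2) =
          f \o (fun p => rscale x p.1 + rscale y p.2) by exact: rmod_iso_comp.
by case: fi => [[fD fZ] _]; apply/funext => p; rewrite /= fD !fZ.
Qed.

Lemma Sp2_lker0 g : Sp2 sigma g -> lker g == 0%VS.
Proof. by case=> [[_ /lker0_bij]]. Qed.

Lemma Sp2_id : Sp2 sigma (\1%VF : E).
Proof.
split; last by move=> x y; rewrite !id_lfunE.
split; first by apply: rmod_linear_lfun => x a; rewrite !id_lfunE.
by exists id => x; rewrite id_lfunE.
Qed.

Lemma Sp2_comp g h : Sp2 sigma g -> Sp2 sigma h -> Sp2 sigma (g \o h)%VF.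
Proof.
move=> [gi go] [hi ho]; split; last by move=> x y; rewrite !comp_lfunE go ho.
suff -> : (g \o h)%VF = g \o h :> (W -> W) by exact: rmod_iso_comp.
by apply/funext => x; rewrite comp_lfunE.
Qed.

Lemma Sp2_inv g : Sp2 sigma g -> Sp2 sigma (g^-1)%VF.
Proof.
move=> gS; have g0 := Sp2_lker0 gS; case: gS => gi go.
split; first exact: rmod_iso_inv.
by move=> x y; rewrite -go !lker0_lfunVK.
Qed.

Lemma conj_by_is_linear g : linear (conj_by g).
Proof.
by move=> c X Y; rewrite /conj_by comp_lfunDr comp_lfunDl -comp_lfunZr -comp_lfunZl.
Qed.

(** Bundled so that the results on velocity and smoothness under linear maps apply to
    conjugation. *)
Definition conj_by_linear g : {linear E -> E} := HB.pack (conj_by g)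
  (GRing.isSemilinear.Build R E E _ (conj_by g)
    (GRing.semilinear_linear (conj_by_is_linear g))).

Lemma conj_by_id L : conj_by \1%VF L = L.
Proof.
have [_] := lfun_inv_uniq (comp_lfun1l (\1%VF : E)) (comp_lfun1l (\1%VF : E)).
by rewrite /conj_by => ->; rewrite comp_lfun1l comp_lfun1r.
Qed.

Lemma conj_by_comp g h L : lker g == 0%VS -> lker h == 0%VS ->
  conj_by (g \o h)%VF L = conj_by g (conj_by h L).
Proof.
move=> g0 h0; have [||_] := @lfun_inv_uniq _ _ (g \o h)%VF (h^-1 \o g^-1)%VF.
- by rewrite -comp_lfunA lker0_compVKf// lker0_compfV.
- by rewrite -comp_lfunA lker0_compKf// lker0_compVf.
by rewrite /conj_by => ->; rewrite !comp_lfunA.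
Qed.

Lemma conj_byM g L X : lker g == 0%VS ->
  (conj_by g L \o conj_by g X)%VF = conj_by g (L \o X)%VF.
Proof. by move=> g0; rewrite /conj_by -!comp_lfunA lker0_compKf. Qed.

(** Write y = g (g^-1 y) and use that g preserves omega. *)
Lemma hform_conj_by g L x y : Sp2 sigma g ->
  hform sigma (conj_by g L) x y = hform sigma L (g^-1%VF x) (g^-1%VF y).
Proof.
move=> gS; have g0 := Sp2_lker0 gS; case: gS => _ go.
by rewrite /hform !comp_lfunE -[y in LHS](lker0_lfunVK g0) go.
Qed.

(** The form of the conjugate is the form of [J] pulled back along g^-1, an isomorphism that
    preserves regular vectors, so every clause of the inner product is transported. *)
Lemma CG_conj g J : Sp2 sigma g -> CG sigma J -> CG sigma (conj_by g J).
Proof.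
move=> gS [[Jl JJ] [[[Dl Dr Z] sym] pos def]].
have g0 := Sp2_lker0 gS.
have [[giD giZ] gib] := (Sp2_inv gS).1.
split; first split.
- by rewrite /conj_by; do ?apply: rmod_linear_comp_lfun => //; case: gS => [[]].
- rewrite conj_byM// JJ /conj_by comp_lfunNr comp_lfunNl comp_lfun1r lker0_compfV//.
split; first split; first split.
- by move=> x x' y; rewrite !hform_conj_by// linearD Dl.
- by move=> x y y'; rewrite !hform_conj_by// linearD Dr.
- by move=> x y r s; rewrite !hform_conj_by// !giZ Z.
- by move=> x y; rewrite !hform_conj_by// sym.
- move=> x xr; rewrite hform_conj_by//; apply: pos.
  exact: regular_vector_iso (Sp2_inv gS).1 xr.
move=> x; rewrite hform_conj_by//; split=> [/def|->]; last first.
  by apply/def; rewrite linear0.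
by move/(congr1 g); rewrite lker0_lfunVK// linear0.
Qed.

(** Since sigma(omega(L y, x)) = - omega(x, L y), symmetry of the form is skewness of [L] for omega,
    the equation of the Lie algebra of [Sp2]. It is linear in [L] and so can be differentiated.
    Sesquilinearity comes from A-linearity of [L]. *)
Lemma hform_symmetricP L : rmod_linear L ->
  sigma_symmetric sigma (hform sigma L) <->
  forall x y, omega sigma (L x) y = - omega sigma x (L y).
Proof.
move=> [LD LZ]; split=> [[_ sym] x y|skew].
  by rewrite -[LHS]/(hform sigma L x y) sym omega_sigma.
split; first split.
- by move=> x x' y; rewrite /hform linearD omegaDl.
- by move=> x y y'; rewrite /hform omegaDr.
- by move=> x y r s; rewrite /hform LZ omega_rscale.
by move=> x y; rewrite /hform omega_sigma skew.
Qed.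

End SymplecticGroup.

(** * The Cayley transform of an endomorphism anticommuting with J *)

Section CayleyTransform.
Variables (R : realType) (W : vectType R).
Implicit Types (J Y : 'End(W)) (t e : R).

(** A substitute for exp(2tY) with the same velocity 2Y at 0, but rational in t. It has this meaning
    only where 1 - tY is bijective. *)
Definition cayley Y t : 'End(W) := ((\1 + t *: Y) \o (\1 - t *: Y)^-1)%VF.

Lemma affine_lfunE Y (a : R) x : (\1 + a *: Y)%VF x = x + a *: Y x.
Proof. by rewrite add_lfunE id_lfunE scale_lfunE. Qed.

Lemma affine_lfunC Y (a b : R) x :
  (\1 + a *: Y)%VF ((\1 + b *: Y)%VF x) = (\1 + b *: Y)%VF ((\1 + a *: Y)%VF x).
Proof.
rewrite !affine_lfunE.
have YZ (c : R) z : Y (z + c *: Y z) = Y z + c *: Y (Y z).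
  by rewrite linearD linearZ_LR.
by rewrite !YZ !scalerDr !scalerA (mulrC b) addrACA.
Qed.

Lemma affine_lfun_anticomm J Y (a : R) x : (Y \o J)%VF = - (J \o Y)%VF ->
  J ((\1 + a *: Y)%VF x) = (\1 + (- a) *: Y)%VF (J x).
Proof.
move=> YJ; rewrite !affine_lfunE.
have -> : Y (J x) = - J (Y x) by rewrite -!comp_lfunE YJ opp_lfunE.
by rewrite linearD linearZ_LR scalerN scaleNr opprK.
Qed.

Section Invertible.
Variables (Y : 'End(W)) (t : R).
Local Notation P := (\1 + t *: Y)%VF.
Local Notation Q := (\1 - t *: Y)%VF.
Hypotheses (P_bij : bijective P) (Q_bij : bijective Q).

Let P0 : lker P == 0%VS. Proof. exact/lker0_bij. Qed.
Let Q0 : lker Q == 0%VS. Proof. exact/lker0_bij. Qed.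

Lemma cayley_pencil x : cayley Y t (Q x) = P x.
Proof. by rewrite comp_lfunE lker0_lfunK. Qed.

Lemma cayley_lker0 : lker (cayley Y t) == 0%VS.
Proof.
apply/lker0P => x y; rewrite !comp_lfunE => /(lker0P P0).
exact: can_inj (lker0_lfunVK Q0) _ _.
Qed.

Variable J : 'End(W).
Hypothesis YJ : (Y \o J)%VF = - (J \o Y)%VF.

Let JP x : J (P x) = Q (J x).
Proof. by rewrite affine_lfun_anticomm// scaleNr. Qed.

Let JQ x : J (Q x) = P (J x).
Proof.
by have := @affine_lfun_anticomm J Y (- t) x YJ; rewrite opprK scaleNr.
Qed.

Let PQ x : P (Q x) = Q (P x).
Proof. by have := affine_lfunC Y t (- t) x; rewrite scaleNr. Qed.

(** Moving [J] across exchanges [P] and [Q]. For g the Cayley transform and x = Q z, this gives g J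
    g x = g J P z = g Q J z = P J z = J Q z = J x. Hence g J g = J, so J g^-1 = g J. *)
Lemma conj_cayley :
  (cayley Y t \o J \o (cayley Y t)^-1 = cayley Y t \o cayley Y t \o J)%VF.
Proof.
have gJg : (cayley Y t \o J \o cayley Y t = J)%VF.
  apply/lfunP => x; rewrite comp_lfunE comp_lfunE -(lker0_lfunVK Q0 x).
  by rewrite cayley_pencil JP cayley_pencil JQ.
have Jg : (J \o (cayley Y t)^-1 = cayley Y t \o J)%VF.
  by rewrite -[J in LHS]gJg (lker0_compfK cayley_lker0).
by rewrite -comp_lfunA Jg comp_lfunA.
Qed.

(* An equation for [cayley Y t \o J \o (cayley Y t)^-1] whose other terms are
   polynomial in t, so that its velocity is read off by the product rule. *)
Lemma cayley_square_intertwine :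
  ((cayley Y t \o cayley Y t \o J) \o (P \o P) = (P \o P) \o J)%VF.
Proof.
apply/lfunP => x.
rewrite (comp_lfunE _ (P \o P)%VF) (comp_lfunE _ J) (comp_lfunE P P x) JP JP.
rewrite (comp_lfunE _ (cayley Y t)) cayley_pencil PQ cayley_pencil.
by rewrite (comp_lfunE _ J) (comp_lfunE P P).
Qed.

End Invertible.

End CayleyTransform.

(** * A smooth curve of conjugates of J with prescribed velocity *)

Section ConjugationCurve.
Variables (R : realType) (W : vectType R) (J Y : 'End(W)).
Hypothesis YJ : (Y \o J)%VF = - (J \o Y)%VF.

Lemma horner_near_neq0 (d : {poly R}) : d.[0] != 0 ->
  exists2 e, 0 < e & forall s, `|s| < e -> d.[s] != 0.
Proof.
move=> d0; have /nbhs_ballP[e /= e0 He] : \forall s \near (0 : R), d.[s] != 0.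
  have dc : horner d s @[s --> (0 : R)] --> d.[0] by exact: continuous_horner.
  by apply: (cvgr_neq0 _ dc).
by exists e => // s se; apply: He; rewrite /ball /= sub0r normrN.
Qed.

Lemma cayley_curve : exists (gamma : R -> 'End(W)) (e : R),
  [/\ 0 < e, gamma 0 = J,
      forall t, `|t| < e -> smooth_at gamma t,
      forall t, `|t| < e -> [/\ bijective (\1 + t *: Y)%VF,
        bijective (\1 - t *: Y)%VF &
        gamma t = (cayley Y t \o J \o (cayley Y t)^-1)%VF]
    & velocity gamma 0 = (((Y + Y) \o J) - (J \o (Y + Y)))%VF].
Proof.
have [d [N [Npoly d0 Nres]]] := resolvent_rational Y.
have [|e e0 dn0] := @horner_near_neq0 d; first by rewrite d0 oner_neq0.
pose P t : 'End(W) := (\1 + t *: Y)%VF.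
(* This is g(t)^2 J with (1 - tY)^-1 replaced by N(t) / d(t), once for each factor g(t); in this
   form it is visibly rational. *)
pose gamma t := (d.[t] ^- 2 *: ((P t \o N t) \o (P t \o N t) \o J))%VF.
have Qbij t : `|t| < e -> bijective (\1 - t *: Y)%VF /\
    ((\1 - t *: Y)^-1)%VF = d.[t]^-1 *: N t.
  move=> /dn0 dt; have [QN NQ] := Nres t; apply: lfun_inv_uniq.
    by rewrite -comp_lfunZr QN scalerA mulVf// scale1r.
  by rewrite -comp_lfunZl NQ scalerA mulVf// scale1r.
have Pbij t : `|t| < e -> bijective (P t).
  (* 1 + tY is the pencil 1 - sY at s = -t, and the interval is symmetric. *)
  rewrite -normrN => /Qbij[Qb _]; rewrite /P.
  by move: Qb; rewrite scaleNr opprK.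
have gammaE t : `|t| < e -> gamma t = (cayley Y t \o cayley Y t \o J)%VF.
  move=> te; rewrite /cayley (Qbij t te).2 /gamma -/(P t).
  rewrite -!(comp_lfunZr, comp_lfunZl) scalerA -invfM expr2.
  by congr (_ *: _).
have N0 : N 0 = \1%VF.
  by have [+ _] := Nres 0; rewrite scale0r subr0 comp_lfun1l d0 scale1r.
have z0 : `|0 : R| < e by rewrite normr0.
have g0 : gamma 0 = J.
  by rewrite /gamma d0 expr1n invr1 scale1r /P scale0r addr0 N0 !comp_lfun1l.
have gs t : `|t| < e -> smooth_at gamma t.
  move=> te; apply: (smooth_rational_curve (q := d) (k := 2) (e := e)
    (gamma := fun s => ((P s \o N s) \o (P s \o N s) \o J)%VF)) => //.
  apply: polynomial_curve_comp_lfun; last exact: polynomial_curve_cst.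
  by do ![apply: polynomial_curve_comp_lfun] => //; exact: polynomial_curve_affine.
exists gamma, e; split=> //.
  move=> t te; have [Qb _] := Qbij t te; split=> //; first exact: Pbij.
  by rewrite gammaE// conj_cayley//; exact: Pbij.
have P00 : P 0 = \1%VF by rewrite /P scale0r addr0.
have Pv : is_velocity P 0 Y by exact: is_velocity_affine.
have PPv := is_velocity_comp_lfun Pv Pv.
have gPPv := is_velocity_comp_lfun (smooth_at_velocity (gs 0 z0)) PPv.
have PPJv := is_velocity_comp_lfun PPv (is_velocity_cst J 0).
(* Differentiating this identity at 0, where P = 1 and P' = Y, gives 2 Y J = gamma'(0) + 2 J Y, with
   no need to differentiate an inverse. *)
have : \forall s \near (0 : R), ((P s \o P s) \o J = gamma s \o (P s \o P s))%VF.
  apply: filterS (near_ball0 z0) => s se; rewrite gammaE//.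
  have [Qb _] := Qbij s se.
  by rewrite (cayley_square_intertwine Qb YJ).
move=> /near_eq_is_velocity /(_ PPJv) /(is_velocity_unique gPPv).
rewrite g0 P00 !(comp_lfun1l, comp_lfun1r) addr0 => <-.
by rewrite addrK.
Qed.

End ConjugationCurve.

(** * Tangent spaces of [CG] and their behaviour under conjugation *)

Section TangentSpaceCG.
Variables (R : realType) (A : falgType R) (sigma : A -> A).
Hypothesis hanti : anti_involution sigma.
Local Notation W := (A * A)%type.
Local Notation E := ('End((A * A)%type)).
Implicit Types (g J L Y : E).

(** With x = (1 - tY) u and y = (1 - tY) v, the claim compares omega on (1 + tY) u, (1 + tY) v with
    omega on x, y. By skewness the terms of first order in t cancel on both sides, and the remaining
    ones do not change under t -> -t. *)
Lemma cayley_Sp2 Y t :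
    rmod_linear Y ->
    (forall x y, omega sigma (Y x) y = - omega sigma x (Y y)) ->
    bijective (\1 + t *: Y)%VF -> bijective (\1 - t *: Y)%VF ->
  Sp2 sigma (cayley Y t).
Proof.
move=> Yl skew Pb Qb.
have /lker0_bij Q0 := Qb.
have Pl : rmod_linear (\1 + t *: Y)%VF by exact: rmod_linear_affine.
have Ql : rmod_linear (\1 - t *: Y)%VF.
  by rewrite -scaleNr; exact: rmod_linear_affine.
split; first split.
- by apply: rmod_linear_comp_lfun => //; exact: rmod_linear_inv.
- exact/lker0_bij/cayley_lker0.
move=> x y; rewrite -[x](lker0_lfunVK Q0) -[y](lker0_lfunVK Q0).
rewrite !(cayley_pencil Qb) -scaleNr !affine_lfunE.
set u := (_ x); set v := (_ y).
rewrite !(omegaDl hanti, omegaDr, omegaZl hanti, omegaZr) !skew.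
rewrite !scalerN !scaleNr !opprK -!addrA; congr (_ + _).
by rewrite addNKr addKr scalerN.
Qed.

Lemma tangent_CG_of_anticomm J L :
    CG sigma J -> rmod_linear L -> sigma_symmetric sigma (hform sigma L) ->
    (L \o J)%VF + (J \o L)%VF = 0 -> tangent_space (CG sigma) J L.
Proof.
move=> JCG Ll Lsym /eqP; rewrite addr_eq0 => /eqP LJ.
have [[Jl JJ] [Jsym _ _]] := JCG.
have Jskew := (hform_symmetricP hanti Jl).1 Jsym.
have Lskew := (hform_symmetricP hanti Ll).1 Lsym.
(* [Y = - L J / 4] solves [2 (Y J - J Y) = L]. *)
pose c : R := - (4%:R)^-1.
pose Y : E := c *: (L \o J)%VF.
have LJJ : (L \o J \o J = - L)%VF by rewrite -comp_lfunA JJ comp_lfunNr comp_lfun1r.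
have JLJ : (J \o (L \o J) = L)%VF.
  have -> : (J \o (L \o J) = (J \o L) \o J)%VF by rewrite comp_lfunA.
  have -> : (J \o L)%VF = - (L \o J)%VF by rewrite LJ opprK.
  by rewrite comp_lfunNl LJJ opprK.
have YJ : (Y \o J)%VF = - (c *: L) by rewrite /Y -comp_lfunZl LJJ scalerN.
have JY : (J \o Y)%VF = c *: L by rewrite /Y -comp_lfunZr JLJ.
have Yl : rmod_linear Y.
  apply: rmod_linear_lfun => x a; rewrite !scale_lfunE.
  have [_ ->] := rmod_linear_comp_lfun Ll Jl.
  by rewrite /rscale; congr pair; rewrite /= scalerAl.
(* Two skew maps that anticommute have a skew product: omega(L J x, y) = - omega(J x, L y) =
   omega(x, J L y) = - omega(x, L J y). *)
have Yskew x y : omega sigma (Y x) y = - omega sigma x (Y y).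
  rewrite !scale_lfunE (omegaZl hanti) omegaZr -scalerN; congr (_ *: _).
  have -> : (L \o J)%VF y = - J (L y) by rewrite LJ opp_lfunE comp_lfunE.
  rewrite -[- J (L y)]scaleN1r omegaZr scaleN1r opprK comp_lfunE Lskew Jskew.
  by rewrite opprK.
have [|gamma [e [e0 g0 gs gE gv]]] := @cayley_curve _ _ J Y.
  by rewrite YJ JY.
exists gamma; first split=> //.
  exists e => // t te; split; first exact: gs.
  have [Pb Qb ->] := gE t te.
  by apply: CG_conj => //; exact: cayley_Sp2.
rewrite gv comp_lfunDl comp_lfunDr YJ JY.
(* As Y J = - c L and J Y = c L, the velocity is - 4 c L, and c = - 1/4 makes it L. *)
have -> : - (c *: L) - c *: L - (c *: L + c *: L) = (- c - c - (c + c)) *: L.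
  by rewrite !(scalerBl, scalerDl, scaleNr).
by have -> : - c - c - (c + c) = 1; [rewrite /c; field|rewrite scale1r].
Qed.

Lemma tangent_CG_sub J L : CG sigma J -> tangent_space (CG sigma) J L ->
  [/\ rmod_linear L, sigma_symmetric sigma (hform sigma L)
    & (L \o J)%VF + (J \o L)%VF = 0].
Proof.
move=> JCG LT.
(* A-linearity comes first, because the skewness criterion for sigma-symmetry presupposes it. *)
have Ll : rmod_linear L.
  apply: rmod_linear_lfun => x a; apply/eqP; rewrite -subr_eq0; apply/eqP.
  apply: (linear_constraint_tangent
    (phi := fun X : E => X (rscale x a) - rscale (X x) a) _ _ LT).
    move=> c X Y; rewrite !add_lfunE !scale_lfunE rscale_linear.
    by rewrite scalerBr opprD addrACA.
  by move=> X [[[_ XZ] _] _]; rewrite XZ subrr.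
split=> //.
  apply/(hform_symmetricP hanti Ll) => x y.
  apply/eqP; rewrite -addr_eq0; apply/eqP.
  apply: (linear_constraint_tangent
    (phi := fun X : E => omega sigma (X x) y + omega sigma x (X y)) _ _ LT).
    move=> c X Y; rewrite !add_lfunE !scale_lfunE (omegaDl hanti) omegaDr.
    by rewrite (omegaZl hanti) omegaZr addrACA -scalerDr.
  move=> X [[Xl _] [Xsym _ _]].
  by rewrite ((hform_symmetricP hanti Xl).1 Xsym) addNr.
(* The equation J^2 = -1 is quadratic, so the product rule replaces the linear argument: L J + J L
   is the velocity of the square of gamma, which is constant near 0. *)
case: LT => gamma [g0 [e e0 gM]] <-.
have z0 : `|0 : R| < e by rewrite normr0.
have gv := smooth_at_velocity (gM 0 z0).1.
have := is_velocity_comp_lfun gv gv; rewrite g0 => /is_velocity_unique; apply.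
apply: near_eq_is_velocity (is_velocity_cst (- \1%VF) 0).
by apply: filterS (near_ball0 z0) => s /gM [_ [[_ ->]]].
Qed.

(** Conjugation by a fixed g is R-linear on endomorphisms, so it is its own differential and
    preserves smoothness of curves. *)
Lemma curve_through_conj g J (gamma : R -> E) :
    Sp2 sigma g -> curve_through (CG sigma) J gamma ->
  curve_through (CG sigma) (conj_by g J) (fun t => conj_by g (gamma t)) /\
  velocity (fun t => conj_by g (gamma t)) 0 = conj_by g (velocity gamma 0).
Proof.
move=> gS [g0 [e e0 gM]].
have z0 : `|0 : R| < e by rewrite normr0.
split; last first.
  apply: is_velocityE.
  exact: is_velocity_linear (conj_by_linear g) _ _ _ (smooth_at_velocity (gM 0 z0).1).
split; first by rewrite g0.
exists e => // t te; split; last by apply: CG_conj; [|have [] := gM t te].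
by apply: (smooth_linear (phi := conj_by_linear g) (gamma := gamma) _ te) => s /gM [].
Qed.

Lemma tangent_space_conj g J L :
    Sp2 sigma g -> tangent_space (CG sigma) J L ->
  tangent_space (CG sigma) (conj_by g J) (conj_by g L).
Proof.
move=> gS [gamma gJ <-]; have [gc gv] := curve_through_conj gS gJ.
by exists (fun t => conj_by g (gamma t)).
Qed.

Lemma conj_byK g L : Sp2 sigma g -> conj_by g (conj_by (g^-1)%VF L) = L.
Proof.
move=> gS; rewrite -conj_by_comp; last 2 first.
- exact: Sp2_lker0 gS.
- exact: Sp2_lker0 (Sp2_inv gS).
by rewrite lker0_compfV ?conj_by_id ?(Sp2_lker0 gS).
Qed.

Lemma conj_byVK g L : Sp2 sigma g -> conj_by (g^-1)%VF (conj_by g L) = L.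
Proof.
move=> gS; rewrite -conj_by_comp; last 2 first.
- exact: Sp2_lker0 (Sp2_inv gS).
- exact: Sp2_lker0 gS.
by rewrite lker0_compVf ?conj_by_id ?(Sp2_lker0 gS).
Qed.

End TangentSpaceCG.

Theorem proposition6p3 (R : realType) (A : falgType R) (sigma : A -> A)
    (hss : semisimple_algebra A) (hanti : anti_involution sigma)
    (hherm : hermitian_algebra sigma) :
  [/\ (* the tangent space at J *)
      forall J : 'End((A * A)%type), CG sigma J ->
        tangent_space (CG sigma) J =
        [set L : 'End((A * A)%type) | [/\ rmod_linear L,
                     sigma_symmetric sigma (hform sigma L)
                   & (L \o J)%VF + (J \o L)%VF = 0]],
      (* Sp2 acts on the tangent bundle by conjugation *)
      group_acts_on (Sp2 sigma) (tangent_bundle (CG sigma)) (@conj_pair R A),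
      (* and this is the action by differentials of J |-> g J g^-1 *)
      forall (g J : 'End((A * A)%type)) (gamma : R -> 'End((A * A)%type)),
        Sp2 sigma g -> CG sigma J -> curve_through (CG sigma) J gamma ->
        curve_through (CG sigma) (conj_by g J) (fun t => conj_by g (gamma t)) /\
        velocity (fun t => conj_by g (gamma t)) 0 = conj_by g (velocity gamma 0)
    & forall g J : 'End((A * A)%type), Sp2 sigma g -> CG sigma J ->
        tangent_space (CG sigma) (conj_by g J) =
        [set conj_by g L | L in tangent_space (CG sigma) J]].
Proof.
split.
- move=> J JCG; apply/seteqP; split=> L /=; first exact: tangent_CG_sub.
  by case=> *; exact: tangent_CG_of_anticomm.
- split.
  + split; [exact: Sp2_id|by move=> g h; exact: Sp2_comp|move=> g gS].
    by rewrite lker0_compfV ?lker0_compVf ?(Sp2_lker0 gS)//; split=> //; exact: Sp2_inv.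
  + move=> g [J L] gS [/= JCG LT].
    by split; [exact: CG_conj|exact: tangent_space_conj].
  + by move=> [J L] _; rewrite /conj_pair /= !conj_by_id.
  + move=> g h [J L] gS hS _; rewrite /conj_pair /=.
    by rewrite !conj_by_comp// ?(Sp2_lker0 gS) ?(Sp2_lker0 hS).
- by move=> g J gamma gS _; exact: curve_through_conj.
move=> g J gS JCG; apply/seteqP; split=> L /=; last first.
  by case=> X XT <-; exact: tangent_space_conj.
(* The reverse inclusion is the forward one applied to g^-1 at the point g J g^-1. *)
move=> LT; exists (conj_by (g^-1)%VF L); last exact: conj_byK gS.
by have := tangent_space_conj (Sp2_inv gS) LT; rewrite (conj_byVK _ gS).
Qed.
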